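(* Let $\gamma$ be a regular loxodromic extremal connecting two points $A$ and $B$. If the strict Legendre condition $3u'^2>f(u)^2$ holds along $\gamma$, then $\gamma$ provides a strict weak local minimizer for the resistance functional, but it fails to be a strong local minimizer.
   Context: $\Sigma$ is a Riemannian surface with geodesic coordinates $(u,v)$ in which the metric is $du^2+f(u)^2dv^2$, where $f$ is a smooth positive function. The points are $A=(u_0,v_0)$ and $B=(u_1,v_1)$ in these coordinates, with $0<u_0<u_1$ and $v_0<v_1$. Curves are written as graphs $u=u(v)$, $v\in[v_0,v_1]$, and the resistance functional is $$\mathcal{R}[u]=\int_{v_0}^{v_1}\frac{f(u)^2}{u'^2+f(u)^2}\,dv.$$ A loxodromic extremal is a solution of $u'=kf(u)$ with $k$ a positive constant (a curve making a constant angle with the curves $v=\text{constant}$). The admissible class is that of monotonic piecewise $C^1$ functions $$\mathcal{C}_{0,1}^m=\{u\in PC^1([v_0,v_1],\mathbb{R}^+):\ u'\ge 0,\ u(v_0)=u_0,\ u(v_1)=u_1\}.$$ Weak and strong local minimizers are understood in the usual sense of the calculus of variations: weak means minimizing among admissible functions $w$ for which both $\sup|w-u|$ and $\sup|w'-u'|$ are small (strict if $\mathcal{R}[w]>\mathcal{R}[u]$ for $w\ne u$), and strong means minimizing among admissible functions $w$ for which only $\sup|w-u|$ is required to be small.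
   Formalization: Failure of strong minimality is false among monotone competitors when k ≥ 1 (e.g. f = 1, k = 2, where γ is a global minimizer); it is stated among all piecewise C^1 graphs joining A to B, and among monotone ones only for k < 1. *)

(* Defs.v *)
From Stdlib Require Import Reals.
From Coquelicot Require Import Coquelicot.
Open Scope R_scope.

(* Functions on an interval [a,b] are represented by total functions R -> R;
   nothing below depends on their values outside [a,b]. *)

Definition smooth_on_Rplus (f : R -> R) : Prop :=
  forall (n : nat) (x : R), 0 < x -> ex_derive_n f n x.

(* C^1 on the closed interval: the derivative on the open interval extends
   continuously to the end points, where it is then the one-sided derivative. *)
Definition C1_on (a b : R) (w : R -> R) : Prop :=
  continuous_on (fun v => a <= v <= b) w /\
  exists dw : R -> R,
    continuous_on (fun v => a <= v <= b) dw /\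
    forall v, a < v < b -> is_derive w v (dw v).

(* Consecutive closed pieces share an end point, so such a w is continuous
   on the whole of [a,b]; only its derivative may jump, at the points t i. *)
Definition PC1_on (a b : R) (w : R -> R) : Prop :=
  exists (n : nat) (t : nat -> R),
    t 0%nat = a /\ t n = b /\
    forall i, (i < n)%nat -> t i < t (S i) /\ C1_on (t i) (t (S i)) w.

(* u in PC^1([v0,v1], R^+) joining (u0,v0) to (u1,v1) *)
Definition PC1_class (u0 v0 u1 v1 : R) (u : R -> R) : Prop :=
  PC1_on v0 v1 u /\
  (forall v, v0 <= v <= v1 -> 0 < u v) /\
  u v0 = u0 /\ u v1 = u1.

(* The class C^m_{0,1}; u' >= 0 is required wherever u' exists. *)
Definition monotone_PC1_class (u0 v0 u1 v1 : R) (u : R -> R) : Prop :=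
  PC1_class u0 v0 u1 v1 u /\
  forall v, v0 < v < v1 -> ex_derive u v -> 0 <= Derive u v.

(* At the finitely many corners of a piecewise C^1 function, Derive takes an
   arbitrary value, which does not affect the integral. *)
Definition resistance (f : R -> R) (v0 v1 : R) (u : R -> R) : R :=
  RInt (fun v => (f (u v)) ^ 2 / ((Derive u v) ^ 2 + (f (u v)) ^ 2)) v0 v1.

Definition loxodromic_extremal (f : R -> R) (v0 v1 k : R) (u : R -> R) : Prop :=
  0 < k /\
  C1_on v0 v1 u /\
  (forall v, v0 <= v <= v1 -> 0 < u v) /\
  (forall v, v0 < v < v1 -> is_derive u v (k * f (u v))).

Definition strict_Legendre (f : R -> R) (v0 v1 : R) (u : R -> R) : Prop :=
  forall v, v0 < v < v1 -> 3 * (Derive u v) ^ 2 > (f (u v)) ^ 2.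

Definition C0_close (v0 v1 eps : R) (u w : R -> R) : Prop :=
  forall v, v0 <= v <= v1 -> Rabs (w v - u v) < eps.

(* The derivatives are compared wherever both exist. *)
Definition C1_close (v0 v1 eps : R) (u w : R -> R) : Prop :=
  C0_close v0 v1 eps u w /\
  forall v, v0 < v < v1 -> ex_derive u v -> ex_derive w v ->
    Rabs (Derive w v - Derive u v) < eps.

Definition strict_weak_local_minimizer (adm : (R -> R) -> Prop)
    (J : (R -> R) -> R) (v0 v1 : R) (u : R -> R) : Prop :=
  adm u /\
  exists eps : R, 0 < eps /\
    forall w, adm w -> C1_close v0 v1 eps u w ->
      (exists v, v0 <= v <= v1 /\ w v <> u v) -> J u < J w.

Definition strong_local_minimizer (adm : (R -> R) -> Prop)
    (J : (R -> R) -> R) (v0 v1 : R) (u : R -> R) : Prop :=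
  adm u /\
  exists eps : R, 0 < eps /\
    forall w, adm w -> C0_close v0 v1 eps u w -> J u <= J w.

(* Main.v *)
Require Import Defs.
From Stdlib Require Import Reals Lra Lia.
From Coquelicot Require Import Coquelicot.
Open Scope R_scope.

(** Let [G' = 1 / f], so that [G (u v)] is the isothermal height of the curve.
    With [p = w' / f (w)], the derivative of [G o w], the resistance of [w] is
    the integral of [1 / (1 + p^2)], and loxodromes are the curves on which
    [p = k] is constant.  The integral of [p] depends only on the end points.
    Subtracting the tangent line of [1 / (1 + p^2)] at [p = k] therefore gives
      [J w - J u = integral of excess k p],
      [excess k p = (p - k)^2 (2 k p + k^2 - 1) / ((1 + p^2) (1 + k^2)^2)],
    and everything is read off from the sign of [2 k p + k^2 - 1].

    Weak minimality.  The Legendre condition says [3 k^2 > 1], so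
    [2 k p + k^2 - 1] is positive at [p = k], hence for [p] near [k], and the
    excess is nonnegative and vanishes only at [p = k]
    ([excess_positive_near], [PC1_excess]).  If the two resistances agree then
    [G o w] and [G o u] are affine with the same slope and the same initial
    value; as [G] is injective, [w = u].

    Failure of strong minimality.  Take [w = u o s], where [s] differs from
    the identity only on a short interval next to [v0], on which it is a tooth:
    slope [1 + d], then slope [m <= 0].  Since [u' = k f (u)], the value of [p]
    for [w] is [k s'], so the resistance of [w] is a sum of three constants
    times lengths, and it lies below that of [u] as soon as
      [(1 + m) (1 + k^2 (1 + d)^2) < (2 + d) (1 + k^2 m^2)]
    ([tooth_resistance_gap]).  This inequality is scale invariant, so the tooth
    can be made as small as desired.  It holds with [m = -1] and any [d > 0]:
    descending at the angle at which [u] ascends costs nothing extra, while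
    the steeper ascent saves resistance.  For [k < 1] it also holds with
    [m = 0] and [d] small, and then [w] is monotone. *)

(** * Calculus on a closed interval *)

Lemma continuous_continuity_pt (g : R -> R) (x : R) :
  continuous g x -> continuity_pt g x.
Proof. intros H. apply continuity_pt_filterlim. exact H. Qed.

Lemma is_derive_continuous (g : R -> R) (x l : R) :
  is_derive g x l -> continuous g x.
Proof. intros H. apply (ex_derive_continuous g). now exists l. Qed.

(** The next two lemmas restate conversions of integrals with equalities in
    [R] itself instead of the carrier of a normed module, which is the form
    that [field] and [lra] recognize. *)
Lemma is_RInt_congr (g : R -> R) (a b l l' : R) :
  is_RInt g a b l -> l = l' -> is_RInt g a b l'.
Proof. now intros H <-. Qed.

Lemma is_RInt_ext_interior (g h : R -> R) (a b l : R) :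
  a <= b -> (forall x, a < x < b -> g x = h x) ->
  is_RInt g a b l -> is_RInt h a b l.
Proof.
  intros Hab He. apply is_RInt_ext. rewrite Rmin_left, Rmax_right by lra. exact He.
Qed.

Lemma locally_interior (a b x : R) (P : R -> Prop) :
  a < x < b -> (forall y, a < y < b -> P y) -> locally x P.
Proof.
  intros [Hax Hxb] HP.
  assert (Hd : 0 < Rmin (x - a) (b - x)) by (apply Rmin_pos; lra).
  exists (mkposreal _ Hd). intros y Hy. apply HP.
  apply Rabs_def2 in Hy. simpl in Hy.
  unfold minus, plus, opp in Hy; simpl in Hy.
  pose proof (Rmin_l (x - a) (b - x)). pose proof (Rmin_r (x - a) (b - x)). lra.
Qed.

Lemma constant_of_derive_zero (g : R -> R) (a b : R) :
  (forall x, a < x < b -> is_derive g x 0) ->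
  (forall x, a <= x <= b -> continuous g x) ->
  forall x, a <= x <= b -> g x = g a.
Proof.
  intros Hd Hc x Hx.
  destruct (MVT_gen g a x (fun _ => 0)) as (c & _ & Hc').
  - intros y Hy. rewrite Rmin_left, Rmax_right in Hy by lra. apply Hd. lra.
  - intros y Hy. rewrite Rmin_left, Rmax_right in Hy by lra.
    apply continuous_continuity_pt, Hc. lra.
  - lra.
Qed.

Lemma nondecreasing_of_derive_nonneg (g dg : R -> R) (a b : R) :
  (forall x, a < x < b -> is_derive g x (dg x)) ->
  (forall x, a <= x <= b -> continuous g x) ->
  (forall x, a <= x <= b -> 0 <= dg x) ->
  forall x y, a <= x -> x <= y -> y <= b -> g x <= g y.
Proof.
  intros Hd Hc Hpos x y Hx Hxy Hy.
  destruct (MVT_gen g x y dg) as (c & Hc' & Hm);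
    rewrite ?Rmin_left, ?Rmax_right in * by lra.
  - intros z Hz. apply Hd. lra.
  - intros z Hz. apply continuous_continuity_pt, Hc. lra.
  - assert (0 <= dg c) by (apply Hpos; lra). nra.
Qed.

(** This covers the corners of a piecewise C^1 function at which it happens to
    be derivable, where no formula for the derivative is at hand. *)
Lemma Derive_nonneg_of_nondecreasing (w : R -> R) (a b v : R) :
  (forall x y, a <= x -> x <= y -> y <= b -> w x <= w y) ->
  a < v < b -> ex_derive w v -> 0 <= Derive w v.
Proof.
  intros Hmon Hv Hex. apply Derive_correct, is_derive_Reals in Hex.
  set (l := Derive w v) in *.
  destruct (Rle_dec 0 l) as [Hl | Hl]; [exact Hl | exfalso].
  destruct (Hex (- l) ltac:(lra)) as [d Hd].
  assert (Hd0 := cond_pos d).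
  set (h := Rmin (d / 2) ((b - v) / 2)).
  assert (Hh : 0 < h /\ h < d /\ v + h <= b).
  { unfold h, Rmin. destruct Rle_dec; repeat split; lra. }
  specialize (Hd h ltac:(lra)). rewrite Rabs_right in Hd by lra.
  specialize (Hd ltac:(lra)). apply Rabs_def2 in Hd.
  assert (w v <= w (v + h)) by (apply Hmon; lra).
  assert (0 <= (w (v + h) - w v) / h) by (apply Rdiv_le_0_compat; lra).
  lra.
Qed.

(** Composition with this retraction onto [[a, b]] turns one-sided continuity at
    the end points into continuity on the whole line. *)
Definition clamp (a b x : R) : R := Rmax a (Rmin x b).

Lemma clamp_range (a b x : R) : a <= b -> a <= clamp a b x <= b.
Proof. intros H. unfold clamp, Rmax, Rmin. repeat destruct Rle_dec; lra. Qed.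

Lemma clamp_id (a b x : R) : a <= x <= b -> clamp a b x = x.
Proof. intros H. unfold clamp, Rmax, Rmin. repeat destruct Rle_dec; lra. Qed.

Lemma clamp_continuous (a b x : R) : continuous (clamp a b) x.
Proof.
  apply filterlim_locally. intros eps. exists eps. intros y Hy.
  apply Rabs_def2 in Hy. apply Rabs_def1;
  unfold minus, plus, opp in *; simpl in *;
  unfold clamp, Rmax, Rmin; repeat destruct Rle_dec; lra.
Qed.

Lemma continuous_clamp_extension (a b : R) (g : R -> R) :
  a <= b -> continuous_on (fun v => a <= v <= b) g ->
  forall x, continuous (fun y => g (clamp a b y)) x.
Proof.
  intros Hab Hg x.
  pose proof (clamp_range a b x Hab) as Hx.
  specialize (Hg _ Hx).
  refine (filterlim_comp _ _ _ _ _ _ _ _ _ Hg).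
  intros P HP. pose proof (clamp_continuous a b x _ HP) as HQ.
  unfold filtermap in *. revert HQ. apply filter_imp. intros y Hy.
  apply Hy, clamp_range, Hab.
Qed.

(** A function that is C^1 on [[a, b]] in the one-sided sense is the restriction
    of a function that is C^1 on [R], obtained by integrating the extended
    derivative.  This makes the two-sided calculus of derivatives and integrals
    available up to the end points of each smooth piece. *)
Lemma C1_on_extension (a b : R) (w : R -> R) :
  a < b -> C1_on a b w ->
  exists W dW : R -> R,
    (forall x, is_derive W x (dW x)) /\ (forall x, continuous dW x) /\
    (forall x, a <= x <= b -> W x = w x).
Proof.
  intros Hab (Hw & dw & Hdw & Hder).
  set (dW := fun y => dw (clamp a b y)).
  assert (HdW : forall x, continuous dW x)
    by (apply continuous_clamp_extension; [lra | exact Hdw]).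
  set (W := fun x => w a + RInt dW a x).
  assert (HW : forall x, is_derive W x (dW x)).
  { intros x. unfold W. replace (dW x) with (0 + dW x) by ring.
    apply (is_derive_plus (fun _ => w a) (fun x => RInt dW a x)).
    - apply (is_derive_const (w a) x).
    - apply (is_derive_RInt dW (fun y => RInt dW a y) a x).
      + apply filter_forall. intros y. apply (RInt_correct dW).
        apply (ex_RInt_continuous dW). intros z _. apply HdW.
      + apply HdW. }
  exists W, dW. split; [exact HW | split; [exact HdW | ]].
  intros x Hx.
  pose (D := fun y => w (clamp a b y) - W y).
  assert (HD : D x = D a).
  { apply (constant_of_derive_zero D a b); [ | | exact Hx].
    - intros y Hy. unfold D. replace 0 with (dW y - dW y) by ring.
      apply (is_derive_minus (fun y => w (clamp a b y)) W); [ | apply HW].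
      apply (is_derive_ext_loc w).
      + apply (locally_interior a b); [exact Hy | ].
        intros z Hz. rewrite clamp_id; [reflexivity | lra].
      + unfold dW. rewrite clamp_id by lra. now apply Hder.
    - intros y _. apply (continuous_minus (fun y => w (clamp a b y)) W).
      + apply continuous_clamp_extension; [lra | exact Hw].
      + apply (is_derive_continuous _ _ _ (HW y)). }
  unfold D in HD. rewrite !clamp_id in HD by lra.
  assert (W a = w a).
  { unfold W. rewrite RInt_point. unfold zero; simpl. ring. }
  lra.
Qed.

Lemma extension_derive (a b : R) (w W dW : R -> R) :
  (forall x, is_derive W x (dW x)) -> (forall x, a <= x <= b -> W x = w x) ->
  forall x, a < x < b -> is_derive w x (dW x).
Proof.
  intros HW He x Hx. apply (is_derive_ext_loc W); [ | apply HW].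
  apply (locally_interior a b); [exact Hx | ]. intros y Hy. apply He. lra.
Qed.

(** Induction over the smooth pieces of [w], formulated on the right end point
    of the interval treated so far; the subdivision no longer appears. *)
Lemma PC1_on_ind (a b : R) (w : R -> R) (Q : R -> Prop) :
  PC1_on a b w -> Q a ->
  (forall c d, a <= c -> c < d -> d <= b -> C1_on c d w -> Q c -> Q d) ->
  Q b.
Proof.
  intros (n & t & Ht0 & Htn & Hstep) Ha Hind.
  assert (Hup : forall j, (j <= n)%nat -> t (n - j)%nat <= b).
  { induction j as [|j IH]; intros Hj.
    - replace (n - 0)%nat with n by lia. lra.
    - destruct (Hstep (n - S j)%nat) as [Hlt _]; [lia | ].
      replace (S (n - S j)) with (n - j)%nat in Hlt by lia.
      specialize (IH ltac:(lia)). lra. }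
  assert (Hmain : forall i, (i <= n)%nat -> a <= t i /\ Q (t i)).
  { induction i as [|i IH]; intros Hi.
    - rewrite Ht0. split; [lra | exact Ha].
    - destruct (IH ltac:(lia)) as [Hai HQ].
      destruct (Hstep i) as [Hlt HC]; [lia | ].
      split; [lra | ]. apply (Hind (t i)); try assumption.
      specialize (Hup (n - S i)%nat ltac:(lia)).
      replace (n - (n - S i))%nat with (S i) in Hup by lia. exact Hup. }
  rewrite <- Htn. apply Hmain. lia.
Qed.

(** If [g] were positive at [x], continuity would give a small interval around
    [x] that alone contributes a positive amount to the integral. *)
Lemma RInt_zero_nonneg (g : R -> R) (a b : R) :
  (forall x, a <= x <= b -> continuous g x) ->
  (forall x, a < x < b -> 0 <= g x) -> RInt g a b = 0 ->
  forall x, a < x < b -> g x = 0.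
Proof.
  intros Hc Hpos Hint x Hx.
  destruct (Rle_lt_or_eq_dec _ _ (Hpos x Hx)) as [Hlt | He]; [exfalso | lra].
  assert (Hloc : locally x (fun y => 0 < g y)).
  { apply (Hc x ltac:(lra)). apply (open_gt 0). exact Hlt. }
  destruct Hloc as [d Hd].
  set (c := Rmax a (x - d / 2)). set (e := Rmin b (x + d / 2)).
  assert (Hd0 := cond_pos d).
  assert (Hce : a <= c /\ c < x /\ x < e /\ e <= b /\ x - d < c /\ e < x + d).
  { unfold c, e, Rmax, Rmin. repeat destruct Rle_dec; repeat split; lra. }
  assert (Hex : forall y z, a <= y -> y <= z -> z <= b -> ex_RInt g y z).
  { intros y z Hy Hyz Hz. apply (ex_RInt_continuous g). intros s Hs.
    rewrite Rmin_left, Rmax_right in Hs by lra. apply Hc. lra. }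
  assert (H1 : 0 <= RInt g a c)
    by (apply RInt_ge_0; [lra | apply Hex; lra | intros; apply Hpos; lra]).
  assert (H3 : 0 <= RInt g e b)
    by (apply RInt_ge_0; [lra | apply Hex; lra | intros; apply Hpos; lra]).
  assert (H2 : 0 < RInt g c e).
  { apply RInt_gt_0; [lra | | intros; apply Hc; lra].
    intros y Hy. apply Hd. apply Rabs_def1; unfold minus, plus, opp; simpl; lra. }
  assert (Hs1 := RInt_Chasles g a c e ltac:(apply Hex; lra) ltac:(apply Hex; lra)).
  assert (Hs2 := RInt_Chasles g a e b ltac:(apply Hex; lra) ltac:(apply Hex; lra)).
  unfold plus in Hs1, Hs2; simpl in Hs1, Hs2. lra.
Qed.

(** * The excess of the resistance *)

Definition resistance_density (f w : R -> R) (v : R) : R :=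
  f (w v) ^ 2 / (Derive w v ^ 2 + f (w v) ^ 2).

(** Weierstrass excess of [1 / (1 + p^2)] at the slope [k]. *)
Definition excess (k p : R) : R :=
  (p - k) ^ 2 * (2 * k * p + k ^ 2 - 1) / ((1 + p ^ 2) * (1 + k ^ 2) ^ 2).

Lemma tangent_plus_excess (k p : R) :
  1 / (1 + p ^ 2) =
  1 / (1 + k ^ 2) - 2 * k / (1 + k ^ 2) ^ 2 * (p - k) + excess k p.
Proof.
  unfold excess. assert (0 <= p ^ 2) by apply pow2_ge_0.
  assert (0 <= k ^ 2) by apply pow2_ge_0. field. lra.
Qed.

Lemma excess_continuous (k : R) (p : R -> R) (x : R) :
  continuous p x -> continuous (fun y => excess k (p y)) x.
Proof.
  intros Hp. apply (continuous_comp p (excess k)); [exact Hp | ].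
  apply (ex_derive_continuous (excess k)). unfold excess. auto_derive.
  assert (0 <= p x * (p x * 1)) by (simpl; nra).
  assert (0 <= k * (k * 1)) by nra. nra.
Qed.

(** In the coordinate [G] the metric is [f^2 (dG^2 + dv^2)], so that angles are
    Euclidean and loxodromes are straight lines. *)
Lemma isothermal_coordinate (f : R -> R) :
  (forall x, 0 < x -> 0 < f x) ->
  (forall x, 0 < x -> continuous f x) ->
  exists G : R -> R, forall x, 0 < x -> is_derive G x (/ f x).
Proof.
  intros Hpos Hc. exists (fun x => RInt (fun s => / f s) 1 x).
  assert (Hi : forall x, 0 < x -> continuous (fun s => / f s) x).
  { intros x Hx. apply (continuous_comp f Rinv); [now apply Hc | ].
    apply continuous_Rinv. specialize (Hpos x Hx). lra. }
  intros x Hx.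
  apply (is_derive_RInt (fun s => / f s) (fun y => RInt (fun s => / f s) 1 y) 1 x);
    [ | now apply Hi].
  apply (locally_interior 0 (x + 1)); [lra | ]. intros y Hy.
  apply (RInt_correct (fun s => / f s)), (ex_RInt_continuous (fun s => / f s)).
  intros z Hz. apply Hi.
  assert (0 < Rmin 1 y) by (apply Rmin_pos; lra). lra.
Qed.

Lemma isothermal_coordinate_injective (f G : R -> R) (x y : R) :
  (forall x, 0 < x -> 0 < f x) ->
  (forall x, 0 < x -> is_derive G x (/ f x)) ->
  0 < x -> 0 < y -> G x = G y -> x = y.
Proof.
  intros Hpos HG Hx Hy He.
  assert (0 < Rmin x y) by (apply Rmin_pos; lra).
  destruct (MVT_gen G x y (fun z => / f z)) as (c & Hc & Hm).
  - intros z Hz. apply HG. lra.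
  - intros z Hz. apply continuous_continuity_pt.
    apply (is_derive_continuous _ _ (/ f z)), HG. lra.
  - assert (0 < / f c) by (apply Rinv_0_lt_compat, Hpos; lra). nra.
Qed.

(** On a smooth piece, integrate [tangent_plus_excess] at [p = w' / f (w)]: the
    integral of [p] is the increment of [G o w], and what remains is the
    integral [E] of the excess.  The hypothesis on the derivative is
    [2 k p + k^2 - 1 > 0] multiplied by [f (w)], so the excess is nonnegative
    and can vanish only where [p = k]. *)
Lemma piece_excess (f G : R -> R) (k a b : R) (w : R -> R) :
  (forall x, 0 < x -> 0 < f x) ->
  (forall x, 0 < x -> continuous f x) ->
  (forall x, 0 < x -> is_derive G x (/ f x)) ->
  a < b -> C1_on a b w -> (forall v, a <= v <= b -> 0 < w v) ->
  (forall v, a < v < b -> ex_derive w v ->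
     0 < 2 * k * Derive w v + (k ^ 2 - 1) * f (w v)) ->
  exists E, 0 <= E /\
    is_RInt (resistance_density f w) a b
      ((b - a) / (1 + k ^ 2)
       - 2 * k / (1 + k ^ 2) ^ 2 * (G (w b) - G (w a) - k * (b - a)) + E) /\
    (E = 0 -> forall x, a <= x <= b -> G (w x) - G (w a) = k * (x - a)).
Proof.
  intros Hpos Hfc HG Hab HC Hw Hex.
  destruct (C1_on_extension a b w Hab HC) as (W & dW & HW & HdW & He).
  assert (HW0 : forall x, a <= x <= b -> 0 < W x)
    by (intros x Hx; rewrite He by exact Hx; auto).
  assert (HDw : forall x, a < x < b -> is_derive w x (dW x))
    by (apply (extension_derive a b w W dW); assumption).
  set (p := fun x => dW x / f (W x)).
  assert (Hpc : forall x, a <= x <= b -> continuous p x).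
  { intros x Hx. unfold p, Rdiv.
    apply (continuous_mult dW (fun x => / f (W x))); [apply HdW | ].
    apply (continuous_comp (fun x => f (W x)) Rinv).
    - apply (continuous_comp W f); [apply (is_derive_continuous _ _ _ (HW x)) | ].
      apply Hfc, HW0, Hx.
    - apply continuous_Rinv. specialize (Hpos _ (HW0 x Hx)). lra. }
  assert (HGW : forall x, a <= x <= b -> is_derive (fun y => G (W y)) x (p x)).
  { intros x Hx. apply (is_derive_comp G W); [apply HG, HW0, Hx | apply HW]. }
  assert (Hslope : forall x, a < x < b -> 0 < 2 * k * p x + k ^ 2 - 1).
  { intros x Hx. pose proof (Hex x Hx (ex_intro _ _ (HDw x Hx))) as H.
    rewrite (is_derive_unique _ _ _ (HDw x Hx)), <- He in H by lra.
    assert (Hf := Hpos _ (HW0 x ltac:(lra))).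
    replace (2 * k * p x + k ^ 2 - 1) with
      ((2 * k * dW x + (k ^ 2 - 1) * f (W x)) / f (W x)) by (unfold p; field; lra).
    apply Rdiv_lt_0_compat; assumption. }
  assert (Hden : forall q, 0 < (1 + q ^ 2) * (1 + k ^ 2) ^ 2).
  { intros q. assert (0 <= q ^ 2) by apply pow2_ge_0.
    assert (0 <= k ^ 2) by apply pow2_ge_0.
    apply Rmult_lt_0_compat; [lra | apply pow_lt; lra]. }
  assert (HE0 : forall x, a < x < b -> 0 <= excess k (p x)).
  { intros x Hx. unfold excess. apply Rdiv_le_0_compat; [ | apply Hden].
    apply Rmult_le_pos; [apply pow2_ge_0 | apply Rlt_le, Hslope, Hx]. }
  assert (HEc : forall x, a <= x <= b -> continuous (fun y => excess k (p y)) x)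
    by (intros x Hx; apply excess_continuous, Hpc, Hx).
  assert (HEx : ex_RInt (fun y => excess k (p y)) a b).
  { apply (ex_RInt_continuous (fun y => excess k (p y))). intros x Hx.
    rewrite Rmin_left, Rmax_right in Hx by lra. now apply HEc. }
  exists (RInt (fun y => excess k (p y)) a b). split; [ | split].
  - apply RInt_ge_0; [lra | exact HEx | exact HE0].
  - apply (is_RInt_ext_interior (fun x => 1 / (1 + k ^ 2)
        - 2 * k / (1 + k ^ 2) ^ 2 * (p x - k) + excess k (p x))); [lra | | ].
    { intros x Hx.
      rewrite <- tangent_plus_excess. unfold resistance_density, p.
      rewrite (is_derive_unique _ _ _ (HDw x Hx)), <- He by lra.
      assert (Hf := Hpos _ (HW0 x ltac:(lra))).
      assert (0 <= dW x ^ 2) by apply pow2_ge_0.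
      assert (0 < f (W x) ^ 2) by (apply pow_lt; lra).
      field. split; nra. }
    assert (Hp : is_RInt p a b (G (w b) - G (w a))).
    { rewrite <- !He by lra.
      apply (is_RInt_derive (fun y => G (W y)) p); intros x Hx;
        rewrite Rmin_left, Rmax_right in Hx by lra; auto. }
    assert (Hc1 := is_RInt_const a b (1 / (1 + k ^ 2))).
    assert (Hc2 := is_RInt_const a b k).
    assert (H3 := is_RInt_scal _ _ _ (2 * k / (1 + k ^ 2) ^ 2) _
                    (is_RInt_minus _ _ _ _ _ _ Hp Hc2)).
    assert (H := is_RInt_plus _ _ _ _ _ _ (is_RInt_minus _ _ _ _ _ _ Hc1 H3)
                   (RInt_correct _ _ _ HEx)).
    refine (is_RInt_congr _ _ _ _ _ H _).
    unfold plus, minus, scal, opp, mult; simpl; unfold plus, scal, opp, mult; simpl.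
    field. assert (0 <= k ^ 2) by apply pow2_ge_0. simpl in *; lra.
  - intros HEz.
    assert (Hpk : forall x, a < x < b -> p x = k).
    { intros x Hx.
      pose proof (RInt_zero_nonneg _ _ _ HEc HE0 HEz x Hx) as H0.
      unfold excess, Rdiv in H0. simpl in H0.
      apply Rmult_integral in H0. destruct H0 as [H0 | H0].
      - specialize (Hslope x Hx). simpl in Hslope.
        apply Rmult_integral in H0. destruct H0 as [H0 | H0]; nra.
      - pose proof (Rinv_0_lt_compat _ (Hden (p x))) as Hi. simpl in Hi. lra. }
    intros x Hx.
    assert (H := constant_of_derive_zero (fun y => G (W y) - k * y) a b).
    rewrite <- !He by lra.
    cut (G (W x) - k * x = G (W a) - k * a); [lra | ].
    apply H; [ | | exact Hx].
    + intros y Hy. replace 0 with (p y - k) by (rewrite Hpk by exact Hy; ring).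
      apply (is_derive_minus (fun y => G (W y)) (fun y => k * y));
        [apply HGW; lra | auto_derive; [exact I | ring]].
    + intros y Hy. apply (continuous_minus (fun y => G (W y)) (fun y => k * y)).
      * apply (is_derive_continuous _ _ (p y)), HGW, Hy.
      * apply (ex_derive_continuous (fun y => k * y)). auto_derive. exact I.
Qed.

(** Both the integral and the increment of [G o w] are additive, so the pieces
    add up; if the total excess vanishes then each piece is a segment of slope
    [k] and these segments join at the common end points. *)
Lemma PC1_excess (f G : R -> R) (k v0 v1 : R) (w : R -> R) :
  (forall x, 0 < x -> 0 < f x) ->
  (forall x, 0 < x -> continuous f x) ->
  (forall x, 0 < x -> is_derive G x (/ f x)) ->
  PC1_on v0 v1 w -> (forall v, v0 <= v <= v1 -> 0 < w v) ->
  (forall v, v0 < v < v1 -> ex_derive w v ->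
     0 < 2 * k * Derive w v + (k ^ 2 - 1) * f (w v)) ->
  exists E, 0 <= E /\
    resistance f v0 v1 w =
      (v1 - v0) / (1 + k ^ 2)
      - 2 * k / (1 + k ^ 2) ^ 2 * (G (w v1) - G (w v0) - k * (v1 - v0)) + E /\
    (E = 0 -> forall x, v0 <= x <= v1 -> G (w x) - G (w v0) = k * (x - v0)).
Proof.
  intros Hpos Hfc HG HPC Hw Hex.
  set (Q := fun x => exists E, 0 <= E /\
    is_RInt (resistance_density f w) v0 x
      ((x - v0) / (1 + k ^ 2)
      - 2 * k / (1 + k ^ 2) ^ 2 * (G (w x) - G (w v0) - k * (x - v0)) + E) /\
    (E = 0 -> forall y, v0 <= y <= x -> G (w y) - G (w v0) = k * (y - v0))).
  assert (HQ : Q v1).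
  { apply (PC1_on_ind v0 v1 w); [exact HPC | | ].
    - exists 0. split; [lra | split].
      + assert (H := is_RInt_point (resistance_density f w) v0).
        refine (is_RInt_congr _ _ _ _ _ H _).
        unfold zero; simpl. field. nra.
      + intros _ y Hy. replace y with v0 by lra. ring.
    - intros c d Hc Hcd Hd HC (E & HE & HI & HEq).
      destruct (piece_excess f G k c d w) as (E' & HE' & HI' & HEq');
        try assumption.
      { intros v Hv. apply Hw. lra. }
      { intros v Hv. apply Hex. lra. }
      exists (E + E'). split; [lra | split].
      + assert (H := is_RInt_Chasles _ _ _ _ _ _ HI HI').
        refine (is_RInt_congr _ _ _ _ _ H _).
        unfold plus; simpl. field. nra.
      + intros H0 y Hy. assert (HE0 : E = 0) by lra. assert (HE0' : E' = 0) by lra.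
        destruct (Rle_dec y c) as [Hyc | Hyc]; [apply HEq; lra | ].
        pose proof (HEq HE0 c ltac:(lra)). pose proof (HEq' HE0' y ltac:(lra)). lra. }
  destruct HQ as (E & HE & HI & HEq).
  exists E. split; [exact HE | split; [ | exact HEq]].
  apply is_RInt_unique. exact HI.
Qed.

(** * Loxodromic extremals and their reparametrizations *)

Lemma loxodromic_nondecreasing (f : R -> R) (v0 v1 k : R) (u : R -> R) :
  (forall x, 0 < x -> 0 < f x) -> v0 < v1 ->
  loxodromic_extremal f v0 v1 k u ->
  forall x y, v0 <= x -> x <= y -> y <= v1 -> u x <= u y.
Proof.
  intros Hpos Hv (Hk & HC & Hu & Hder) x y Hx Hxy Hy.
  destruct (C1_on_extension v0 v1 u Hv HC) as (U & dU & HU & _ & He).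
  rewrite <- !He by lra.
  apply (nondecreasing_of_derive_nonneg U (fun z => k * f (U z)) v0 v1);
    try assumption.
  - intros z Hz. apply (is_derive_ext_loc u).
    + apply (locally_interior v0 v1); [exact Hz | ]. intros; rewrite He; lra.
    + rewrite He by lra. now apply Hder.
  - intros z _. apply (is_derive_continuous _ _ _ (HU z)).
  - intros z Hz. rewrite He by exact Hz.
    apply Rmult_le_pos; [lra | apply Rlt_le, Hpos, Hu, Hz].
Qed.

Lemma loxodromic_isothermal_line (f G : R -> R) (v0 v1 k : R) (u : R -> R) :
  (forall x, 0 < x -> 0 < f x) ->
  (forall x, 0 < x -> is_derive G x (/ f x)) -> v0 < v1 ->
  loxodromic_extremal f v0 v1 k u ->
  forall x, v0 <= x <= v1 -> G (u x) - G (u v0) = k * (x - v0).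
Proof.
  intros Hpos HG Hv (Hk & HC & Hu & Hder) x Hx.
  destruct (C1_on_extension v0 v1 u Hv HC) as (U & dU & HU & _ & He).
  assert (H := constant_of_derive_zero (fun y => G (U y) - k * y) v0 v1).
  rewrite <- !He by lra.
  cut (G (U x) - k * x = G (U v0) - k * v0); [lra | ].
  apply H; [ | | exact Hx].
  - intros y Hy.
    assert (HUy : is_derive U y (k * f (u y))).
    { apply (is_derive_ext_loc u); [ | now apply Hder].
      apply (locally_interior v0 v1); [exact Hy | ]. intros; rewrite He; lra. }
    assert (Hfy := Hpos _ (Hu y ltac:(lra))).
    assert (HGy := HG _ (Hu y ltac:(lra))). rewrite <- He in HGy at 1 by lra.
    assert (Hc := is_derive_comp G U y _ _ HGy HUy).
    replace 0 with (scal (k * f (u y)) (/ f (u y)) - k)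
      by (unfold scal; simpl; unfold mult; simpl; field; lra).
    apply (is_derive_minus (fun y => G (U y)) (fun y => k * y));
      [exact Hc | auto_derive; [exact I | ring]].
  - intros y Hy. apply (continuous_minus (fun y => G (U y)) (fun y => k * y)).
    + apply (continuous_comp U G); [apply (is_derive_continuous _ _ _ (HU y)) | ].
      apply (is_derive_continuous _ _ (/ f (U y))), HG.
      rewrite He by exact Hy. now apply Hu.
    + apply (ex_derive_continuous (fun y => k * y)). auto_derive. exact I.
Qed.

(** Traversing the extremal at the constant speed [m] multiplies its slope by
    [m]: since [u' = k f (u)], the composite has [w' = k m f (w)], and its
    resistance density is the constant [1 / (1 + (k m)^2)]. *)
Lemma reparametrized_piece (f : R -> R) (v0 v1 k : R) (u w : R -> R) (a b m n : R) :
  (forall x, 0 < x -> 0 < f x) -> v0 < v1 ->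
  loxodromic_extremal f v0 v1 k u -> a < b ->
  (forall v, a < v < b -> v0 < m * v + n < v1) ->
  (forall v, a <= v <= b -> v0 <= m * v + n <= v1) ->
  (forall v, a <= v <= b -> w v = u (m * v + n)) ->
  C1_on a b w /\
  is_RInt (resistance_density f w) a b ((b - a) / (1 + (k * m) ^ 2)).
Proof.
  intros Hpos Hv (Hk & HC & Hu & Hder) Hab Hin Hcl Hw.
  destruct (C1_on_extension v0 v1 u Hv HC) as (U & dU & HU & HdU & He).
  assert (HW : forall v, is_derive (fun v => U (m * v + n)) v (m * dU (m * v + n))).
  { intros v. apply (is_derive_comp U (fun v => m * v + n)); [apply HU | ].
    auto_derive; [exact I | ring]. }
  assert (HwW : forall v, a <= v <= b -> U (m * v + n) = w v)
    by (intros v Hv'; rewrite Hw, He by auto; reflexivity).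
  assert (Hdw : forall v, a < v < b -> is_derive w v (m * dU (m * v + n)))
    by exact (extension_derive a b w _ _ HW HwW).
  split.
  - split.
    + apply (continuous_on_ext _ (fun v => U (m * v + n))); [exact HwW | ].
      apply continuous_on_forall. intros v _. apply (is_derive_continuous _ _ _ (HW v)).
    + exists (fun v => m * dU (m * v + n)). split; [ | exact Hdw].
      apply continuous_on_forall. intros v _.
      apply (continuous_mult (fun _ => m) (fun v => dU (m * v + n)));
        [apply continuous_const | ].
      apply (continuous_comp (fun v => m * v + n) dU); [ | apply HdU].
      apply (ex_derive_continuous (fun v => m * v + n)). auto_derive. exact I.
  - apply (is_RInt_ext_interior (fun _ => / (1 + (k * m) ^ 2))); [lra | | ].
    + intros v Hv'.
      unfold resistance_density.
      rewrite (is_derive_unique _ _ _ (Hdw v Hv')), Hw by lra.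
      assert (Hdu : dU (m * v + n) = k * f (u (m * v + n))).
      { rewrite <- (is_derive_unique _ _ _ (Hder _ (Hin v Hv'))). symmetry.
        apply is_derive_unique.
        apply (extension_derive v0 v1 u U dU); auto. }
      rewrite Hdu. assert (Hf := Hpos _ (Hu _ (Hcl v ltac:(lra)))).
      set (F := f (u (m * v + n))) in *.
      assert (0 <= (k * m) ^ 2) by apply pow2_ge_0.
      assert (0 < F ^ 2) by (apply pow_lt; lra).
      field. split; nra.
    + assert (H := is_RInt_const a b (/ (1 + (k * m) ^ 2))). exact H.
Qed.

Lemma resistance_loxodromic (f : R -> R) (v0 v1 k : R) (u : R -> R) :
  (forall x, 0 < x -> 0 < f x) -> v0 < v1 ->
  loxodromic_extremal f v0 v1 k u ->
  resistance f v0 v1 u = (v1 - v0) / (1 + k ^ 2).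
Proof.
  intros Hpos Hv Hlox.
  destruct (reparametrized_piece f v0 v1 k u u v0 v1 1 0) as [_ HI];
    try assumption; try (intros; lra).
  - intros v _. f_equal. ring.
  - rewrite Rmult_1_r in HI. apply is_RInt_unique. exact HI.
Qed.

(** * Competitors of smaller resistance *)

(** A broken line in the parameter, for [m <= 0 <= d]: from [v0] it rises with
    slope [1 + d] for a time [(1 - m) c], then has slope [m] for a time [d c],
    and from [v0 + (1 - m + d) c], where it meets the diagonal, it is the
    identity.  The times are in the ratio that makes the average slope [1]. *)
Definition tooth (v0 c m d v : R) : R :=
  let e := v0 + (1 - m + d) * c in
  Rmax v (Rmin (v0 + (1 + d) * (v - v0)) (e + m * (v - e))).

(** The two sides are the resistances, divided by [c], of the tooth and of the
    part of the extremal that it replaces.  Writing [A] and [B] for the two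
    denominators on the left, their difference factors as
    [k^2 d (1 - m) ((2 + d) B - (1 + m) A) / (A B (1 + k^2))]. *)
Lemma tooth_resistance_gap (k m d : R) :
  0 < k -> m < 1 -> 0 < d ->
  (1 + m) * (1 + (k * (1 + d)) ^ 2) < (2 + d) * (1 + (k * m) ^ 2) ->
  (1 - m) / (1 + (k * (1 + d)) ^ 2) + d / (1 + (k * m) ^ 2)
    < (1 - m + d) / (1 + k ^ 2).
Proof.
  intros Hk Hm Hd H.
  set (A := 1 + (k * (1 + d)) ^ 2) in *. set (B := 1 + (k * m) ^ 2) in *.
  assert (HA : 0 < A) by (unfold A; pose proof (pow2_ge_0 (k * (1 + d))); lra).
  assert (HB : 0 < B) by (unfold B; pose proof (pow2_ge_0 (k * m)); lra).
  assert (HC : 0 < 1 + k ^ 2) by (pose proof (pow2_ge_0 k); lra).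
  apply Rlt_0_minus.
  replace ((1 - m + d) / (1 + k ^ 2) - ((1 - m) / A + d / B)) with
    (k ^ 2 * d * (1 - m) * ((2 + d) * B - (1 + m) * A) / (A * B * (1 + k ^ 2)))
    by (unfold A, B in *; field; lra).
  apply Rdiv_lt_0_compat; [ | repeat apply Rmult_lt_0_compat; lra].
  repeat apply Rmult_lt_0_compat; lra.
Qed.

(** Continuity of [u] at [v0] controls the distance: over the tooth both
    [v] and the reparametrized point stay within [r] of [v0].  Choosing
    the height of the tooth at most half of [v1 - v0] also keeps the
    reparametrized points inside [[v0, v1]]. *)
Lemma tooth_competitor (f : R -> R) (v0 v1 k : R) (u : R -> R) (m d eps : R) :
  (forall x, 0 < x -> 0 < f x) -> v0 < v1 ->
  loxodromic_extremal f v0 v1 k u ->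
  -1 <= m <= 0 -> 0 < d ->
  (1 + m) * (1 + (k * (1 + d)) ^ 2) < (2 + d) * (1 + (k * m) ^ 2) ->
  0 < eps ->
  exists w, PC1_class (u v0) v0 (u v1) v1 w /\ C0_close v0 v1 eps u w /\
    resistance f v0 v1 w < resistance f v0 v1 u /\
    (0 <= m -> forall x y, v0 <= x -> x <= y -> y <= v1 -> w x <= w y).
Proof.
  intros Hpos Hv Hlox Hm Hd Hgap Heps.
  assert (Hloc : exists r, 0 < r /\
            forall v, v0 <= v <= v1 -> v < v0 + r -> Rabs (u v - u v0) < eps / 2).
  { destruct Hlox as (_ & [Huc _] & _).
    assert (He2 : 0 < eps / 2) by lra.
    destruct (Huc v0 ltac:(lra) _ (locally_ball (u v0) (mkposreal _ He2)))
      as [r Hr].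
    exists r. split; [apply cond_pos | ]. intros v Hv' Hvr.
    apply Hr; [ | exact Hv'].
    apply Rabs_def1; unfold minus, plus, opp; simpl; pose proof (cond_pos r); lra. }
  destruct Hloc as (r & Hr & Hclose).
  (* L c is the height of the tooth; c makes it half of min r (v1 - v0). *)
  set (L := (1 + d) * (1 - m)).
  assert (HL : 1 - m + d <= L) by (unfold L; nra).
  set (M := Rmin r (v1 - v0)).
  assert (HM : 0 < M /\ M <= r /\ M <= v1 - v0).
  { split; [unfold M; apply Rmin_pos; lra | split; [apply Rmin_l | apply Rmin_r]]. }
  set (c := M / (2 * L)).
  assert (HLp : 0 < L) by lra.
  assert (Hc : 0 < c) by (unfold c; apply Rdiv_lt_0_compat; lra).
  assert (HLc : L * c = M / 2) by (unfold c; field; lra).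
  set (q := v0 + (1 - m) * c). set (e := v0 + (1 - m + d) * c).
  assert (Hq : v0 < q) by (unfold q; nra).
  assert (Hqe : q < e) by (unfold q, e; nra).
  assert (Hev : e <= v0 + L * c) by (unfold e; nra).
  assert (Htop : v0 + (1 + d) * (q - v0) = v0 + L * c) by (unfold q, L; ring).
  assert (Htop' : e + m * (q - e) = v0 + L * c) by (unfold q, e, L; ring).
  set (s := tooth v0 c m d).
  assert (Hs1 : forall v, v0 <= v <= q -> s v = v0 + (1 + d) * (v - v0)).
  { intros v Hv'. unfold s, tooth; fold e.
    rewrite Rmin_left, Rmax_right; nra. }
  assert (Hs2 : forall v, q <= v <= e -> s v = e + m * (v - e)).
  { intros v Hv'. unfold s, tooth; fold e.
    rewrite Rmin_right, Rmax_right; nra. }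
  assert (Hs3 : forall v, e <= v -> s v = v).
  { intros v Hv'. unfold s, tooth; fold e.
    rewrite Rmin_right, Rmax_left; nra. }
  assert (Hrange : forall v, v0 <= v <= v1 -> v0 <= s v <= v1).
  { intros v Hv'. destruct (Rle_dec v q); [rewrite Hs1; nra | ].
    destruct (Rle_dec v e); [rewrite Hs2; nra | rewrite Hs3; lra]. }
  assert (Hlow : forall v, v0 <= v <= e -> s v < v0 + r).
  { intros v Hv'. destruct (Rle_dec v q); [rewrite Hs1; nra | rewrite Hs2; nra]. }
  destruct (reparametrized_piece f v0 v1 k u (fun v => u (s v)) v0 q
              (1 + d) (v0 - (1 + d) * v0)) as [HC1 HI1];
    try assumption; try (intros; nra).
  { intros v Hv'. f_equal. rewrite Hs1 by lra. ring. }
  destruct (reparametrized_piece f v0 v1 k u (fun v => u (s v)) q e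
              m (e - m * e)) as [HC2 HI2];
    try assumption; try (intros; nra).
  { intros v Hv'. f_equal. rewrite Hs2 by lra. ring. }
  destruct (reparametrized_piece f v0 v1 k u (fun v => u (s v)) e v1 1 0)
    as [HC3 HI3]; try assumption; try (intros; lra).
  { intros v Hv'. f_equal. rewrite Hs3 by lra. ring. }
  exists (fun v => u (s v)). split; [ | split; [ | split]].
  - split; [ | split; [ | split]].
    + exists 3%nat, (fun i => match i with 0 => v0 | 1 => q | 2 => e | _ => v1 end)%nat.
      split; [reflexivity | split; [reflexivity | ]].
      intros [ | [ | [ | i]]] Hi; [ | | | exfalso; lia]; split; try assumption; lra.
    + intros v Hv'. apply Hlox, Hrange, Hv'.
    + f_equal. rewrite Hs1 by lra. ring.
    + f_equal. rewrite Hs3 by lra. reflexivity.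
  - intros v Hv'. destruct (Rle_dec e v) as [Hve | Hve].
    + rewrite Hs3, Rminus_diag, Rabs_R0 by exact Hve. exact Heps.
    + assert (H1 := Hclose (s v) (Hrange v Hv') (Hlow v ltac:(lra))).
      assert (H2 := Hclose v Hv' ltac:(lra)).
      apply Rabs_def2 in H1. apply Rabs_def2 in H2. apply Rabs_def1; lra.
  - rewrite (resistance_loxodromic f v0 v1 k u Hpos Hv Hlox).
    assert (HI := is_RInt_Chasles _ _ _ _ _ _
                    (is_RInt_Chasles _ _ _ _ _ _ HI1 HI2) HI3).
    assert (HJ : resistance f v0 v1 (fun v => u (s v))
                 = (q - v0) / (1 + (k * (1 + d)) ^ 2)
                   + (e - q) / (1 + (k * m) ^ 2) + (v1 - e) / (1 + (k * 1) ^ 2))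
      by exact (is_RInt_unique (resistance_density f _) _ _ _ HI).
    rewrite HJ, Rmult_1_r.
    assert (Hg := tooth_resistance_gap k m d ltac:(apply Hlox) ltac:(lra) Hd Hgap).
    apply (Rmult_lt_compat_l c _ _ Hc) in Hg.
    replace (q - v0) with (c * (1 - m)) by (unfold q; ring).
    replace (e - q) with (c * d) by (unfold e, q; ring).
    replace (v1 - e) with (v1 - v0 - c * (1 - m + d)) by (unfold e; ring).
    unfold Rdiv in *. lra.
  - intros Hm0 x y Hx Hxy Hy.
    apply (loxodromic_nondecreasing f v0 v1 k u Hpos Hv Hlox);
      [apply Hrange; lra | | apply Hrange; lra].
    assert (m = 0) by lra. subst m.
    assert (Hcompat : Rmin (v0 + (1 + d) * (x - v0)) e
                      <= Rmin (v0 + (1 + d) * (y - v0)) e)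
      by (apply Rle_min_compat_r; nra).
    unfold s, tooth; fold e. rewrite !Rmult_0_l, !Rplus_0_r.
    apply Rmax_lub; [apply Rle_trans with y; [exact Hxy | apply Rmax_l] | ].
    eapply Rle_trans; [exact Hcompat | apply Rmax_r].
Qed.

(** * Weak and strong minimality *)

Lemma not_strong_of_competitors (adm : (R -> R) -> Prop) (J : (R -> R) -> R)
    (v0 v1 : R) (u : R -> R) :
  (forall eps, 0 < eps ->
     exists w, adm w /\ C0_close v0 v1 eps u w /\ J w < J u) ->
  ~ strong_local_minimizer adm J v0 v1 u.
Proof.
  intros H (_ & eps & Heps & Hmin).
  destruct (H eps Heps) as (w & Hw & Hclose & Hlt).
  specialize (Hmin w Hw Hclose). lra.
Qed.

Lemma strict_weak_local_minimizer_subclass (adm adm' : (R -> R) -> Prop)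
    (J : (R -> R) -> R) (v0 v1 : R) (u : R -> R) :
  (forall w, adm' w -> adm w) -> adm' u ->
  strict_weak_local_minimizer adm J v0 v1 u ->
  strict_weak_local_minimizer adm' J v0 v1 u.
Proof.
  intros Hsub Hu (_ & eps & Heps & H). split; [exact Hu | ].
  exists eps. split; [exact Heps | ]. intros w Hw. apply H, Hsub, Hw.
Qed.

Lemma strict_Legendre_slope (f : R -> R) (v0 v1 k : R) (u : R -> R) :
  (forall x, 0 < x -> 0 < f x) -> v0 < v1 ->
  loxodromic_extremal f v0 v1 k u -> strict_Legendre f v0 v1 u ->
  1 < 3 * k ^ 2.
Proof.
  intros Hpos Hv (_ & _ & Hu & Hder) HL.
  set (v := (v0 + v1) / 2). assert (Hin : v0 < v < v1) by (unfold v; lra).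
  specialize (HL v Hin). rewrite (is_derive_unique _ _ _ (Hder v Hin)) in HL.
  assert (Hf := Hpos _ (Hu v ltac:(lra))).
  assert (Hf2 : 0 < f (u v) ^ 2) by (apply pow_lt; exact Hf).
  rewrite Rpow_mult_distr in HL. nra.
Qed.

(** At [y = x] and [q = k f x] the quantity equals [(3 k^2 - 1) f x], which the
    Legendre condition keeps above a positive constant on [[u0, u1]]; uniform
    continuity of [f] on a slightly larger interval lets [y] and [q] vary. *)
Lemma excess_positive_near (f : R -> R) (u0 u1 k : R) :
  (forall x, 0 < x -> 0 < f x) -> (forall x, 0 < x -> continuous f x) ->
  0 < u0 -> u0 <= u1 -> 0 < k -> 1 < 3 * k ^ 2 ->
  exists eps, 0 < eps /\
    forall x y q, u0 <= x <= u1 -> 0 < y -> Rabs (y - x) < eps ->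
      Rabs (q - k * f x) < eps -> 0 < 2 * k * q + (k ^ 2 - 1) * f y.
Proof.
  intros Hpos Hfc Hu0 Hu01 Hk Hk3.
  destruct (continuity_ab_min f u0 u1 Hu01) as (x0 & Hmin & Hx0).
  { intros x Hx. apply continuous_continuity_pt, Hfc. lra. }
  set (mu := f x0). assert (Hmu : 0 < mu) by (apply Hpos; lra).
  (* The total error is at most (2 k + k^2 + 1) eta < 4 (k^2 + 1 + k) eta. *)
  set (eta := (3 * k ^ 2 - 1) * mu / (4 * (k ^ 2 + 1 + k))).
  assert (Hk2 : 0 < k ^ 2) by (apply pow_lt; exact Hk).
  assert (Heta : 0 < eta).
  { unfold eta. apply Rdiv_lt_0_compat; [apply Rmult_lt_0_compat; lra | lra]. }
  assert (Heta' : 4 * (k ^ 2 + 1 + k) * eta = (3 * k ^ 2 - 1) * mu)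
    by (unfold eta; field; lra).
  destruct (unifcont_normed_1d f (u0 / 2) (u1 + 1)) with (eps := mkposreal _ Heta)
    as [d Hd].
  { intros x Hx. apply Hfc. lra. }
  assert (Hd0 := cond_pos d).
  exists (Rmin (Rmin d eta) (Rmin (u0 / 2) 1)).
  split; [repeat apply Rmin_pos; lra | ].
  intros x y q Hx Hy Hyx Hq.
  assert (Hyx2 : Rabs (y - x) < d /\ Rabs (y - x) < u0 / 2 /\ Rabs (y - x) < 1
           /\ Rabs (q - k * f x) < eta).
  { revert Hyx Hq. unfold Rmin. repeat destruct Rle_dec; intros; repeat split; lra. }
  destruct Hyx2 as (Hy1 & Hy2 & Hy3 & Hq').
  apply Rabs_def2 in Hy2. apply Rabs_def2 in Hy3. apply Rabs_def2 in Hq'.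
  assert (Hfy : Rabs (f y - f x) < eta).
  { apply (Hd x y); [lra | lra | exact Hy1]. }
  apply Rabs_def2 in Hfy.
  assert (Hmx : mu <= f x) by (apply Hmin; exact Hx).
  assert (H1 : (3 * k ^ 2 - 1) * mu <= (3 * k ^ 2 - 1) * f x)
    by (apply Rmult_le_compat_l; lra).
  assert (H2 : - k * eta <= k * (q - k * f x)) by nra.
  assert (H3 : - (k ^ 2 + 1) * eta <= (k ^ 2 - 1) * (f y - f x)) by nra.
  nra.
Qed.

Lemma loxodromic_strict_weak_minimizer (f : R -> R) (v0 v1 k : R) (u : R -> R) :
  (forall x, 0 < x -> 0 < f x) -> (forall x, 0 < x -> continuous f x) ->
  v0 < v1 -> loxodromic_extremal f v0 v1 k u -> 1 < 3 * k ^ 2 ->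
  strict_weak_local_minimizer
    (PC1_class (u v0) v0 (u v1) v1) (resistance f v0 v1) v0 v1 u.
Proof.
  intros Hpos Hfc Hv Hlox Hk3.
  assert (Hu := proj1 (proj2 (proj2 Hlox))).
  assert (Hder := proj2 (proj2 (proj2 Hlox))).
  assert (Hmon := loxodromic_nondecreasing f v0 v1 k u Hpos Hv Hlox).
  assert (Hu0 : 0 < u v0) by (apply Hu; lra).
  split.
  { split; [ | split; [exact Hu | split; reflexivity]].
    exists 1%nat, (fun i => match i with 0 => v0 | _ => v1 end)%nat.
    split; [reflexivity | split; [reflexivity | ]].
    intros [ | i] Hi; [ | exfalso; lia]. split; [exact Hv | apply Hlox]. }
  destruct (excess_positive_near f (u v0) (u v1) k) as (eps & Heps & Hnear);
    try assumption; [apply Hmon; lra | apply Hlox | ].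
  exists eps. split; [exact Heps | ].
  intros w (HPC & Hw & Hw0 & Hw1) [Hclose Hclose'] (v & Hvin & Hne).
  destruct (isothermal_coordinate f Hpos Hfc) as [G HG].
  destruct (PC1_excess f G k v0 v1 w) as (E & HE & HR & HEq); try assumption.
  { intros z Hz Hex. apply (Hnear (u z)).
    - split; apply Hmon; lra.
    - apply Hw. lra.
    - apply Hclose. lra.
    - rewrite <- (is_derive_unique _ _ _ (Hder z Hz)).
      apply Hclose'; [exact Hz | eexists; apply Hder, Hz | exact Hex]. }
  assert (Hline := loxodromic_isothermal_line f G v0 v1 k u Hpos HG Hv Hlox).
  rewrite (resistance_loxodromic f v0 v1 k u Hpos Hv Hlox), HR, Hw0, Hw1.
  rewrite Hline by lra.
  destruct (Rle_lt_or_eq_dec 0 E HE) as [HE' | HE']; [lra | exfalso].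
  apply Hne. apply (isothermal_coordinate_injective f G); try assumption.
  - apply Hw, Hvin.
  - apply Hu, Hvin.
  - pose proof (HEq (eq_sym HE') v Hvin) as H1.
    pose proof (Hline v Hvin). rewrite Hw0 in H1. lra.
Qed.

(* Strong minimality is refuted among all PC^1 graphs joining A to B.  Among
   monotone ones it fails only for k < 1: if k >= 1, the excess
     (p-k)^2 (2kp+k^2-1) / ((1+p^2)(1+k^2)^2),   p = w'/f(w) >= 0,
   is nonnegative, so u minimizes the resistance over all monotone competitors. *)
Theorem corollary5p6 (f : R -> R) (u0 v0 u1 v1 k : R) (u : R -> R)
  (hf_smooth : smooth_on_Rplus f)
  (hf_pos : forall x : R, 0 < x -> 0 < f x)
  (hu0 : 0 < u0) (hu01 : u0 < u1) (hv01 : v0 < v1)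
  (hlox : loxodromic_extremal f v0 v1 k u)
  (hA : u v0 = u0) (hB : u v1 = u1)
  (hLegendre : strict_Legendre f v0 v1 u) :
  strict_weak_local_minimizer
    (monotone_PC1_class u0 v0 u1 v1) (resistance f v0 v1) v0 v1 u /\
  strict_weak_local_minimizer
    (PC1_class u0 v0 u1 v1) (resistance f v0 v1) v0 v1 u /\
  ~ strong_local_minimizer
    (PC1_class u0 v0 u1 v1) (resistance f v0 v1) v0 v1 u /\
  (k < 1 ->
   ~ strong_local_minimizer
     (monotone_PC1_class u0 v0 u1 v1) (resistance f v0 v1) v0 v1 u).
Proof.
  assert (Hfc : forall x, 0 < x -> continuous f x).
  { intros x Hx. apply (ex_derive_continuous f). exact (hf_smooth 1%nat x Hx). }
  assert (Hk3 := strict_Legendre_slope f v0 v1 k u hf_pos hv01 hlox hLegendre).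
  assert (Hk : 0 < k) by apply hlox.
  assert (Hweak := loxodromic_strict_weak_minimizer f v0 v1 k u hf_pos Hfc hv01 hlox Hk3).
  rewrite hA, hB in Hweak.
  split; [ | split; [exact Hweak | split]].
  - apply (strict_weak_local_minimizer_subclass (PC1_class u0 v0 u1 v1));
      [now intros w [Hw _] | | exact Hweak].
    split; [apply Hweak | ]. intros v Hv.
    apply (Derive_nonneg_of_nondecreasing u v0 v1); [ | exact Hv].
    exact (loxodromic_nondecreasing f v0 v1 k u hf_pos hv01 hlox).
  - apply not_strong_of_competitors. intros eps Heps.
    (* Slopes 2 and -1: the resistance on the descent equals that of u. *)
    destruct (tooth_competitor f v0 v1 k u (-1) 1 eps) as (w & Hw & Hc & HJ & _);
      try assumption; try lra.
    rewrite hA, hB in Hw. now exists w.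
  - intros Hk1. apply not_strong_of_competitors. intros eps Heps.
    (* For m = 0 the gap condition reads k^2 (1 + d) < 1; this d is half of the
       largest value allowed. *)
    set (d := (/ k ^ 2 - 1) / 2).
    assert (Hk2 : 0 < k ^ 2) by (apply pow_lt; exact Hk).
    assert (Hd2 : k ^ 2 * (1 + 2 * d) = 1) by (unfold d; field; lra).
    assert (Hd : 0 < d) by nra.
    destruct (tooth_competitor f v0 v1 k u 0 d eps) as (w & Hw & Hc & HJ & Hmon);
      try assumption; try lra; [nra | ].
    rewrite hA, hB in Hw. exists w. split; [ | now split].
    split; [exact Hw | ]. intros v Hv.
    apply (Derive_nonneg_of_nondecreasing w v0 v1); [ | exact Hv].
    apply Hmon. lra.
Qed.
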